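(* Let $K=\mathbb{R}$ or $\mathbb{C}$, let $k,k'$ be nonnegative integers, and let $T$ be the Takasaki quandle of the abelian group $$H=\underbrace{\mathbb{Z}_2\times\cdots\times\mathbb{Z}_2}_{k\text{ times}}\times\underbrace{\mathbb{Z}_4\times\cdots\times\mathbb{Z}_4}_{k'\text{ times}}.$$ Let $X_i$, $0\le i\le 2^{k+k'}-1$, be the orbits of $\mathrm{Inn}(T)$ on $T$. Then $K[T]$ decomposes as a direct sum of simple right ideals $$K[T]=\bigoplus_{i=0}^{2^{k+k'}-1}\left(\bigoplus_{j=1}^{2^{k'}}U_{i,j}\right),$$ where for each $i$ the inner sum equals $K[X_i]$ (the span of $X_i$), and $U_{i,j}$ is the one-dimensional simple module affording the representation $\psi_j$ of $\mathrm{Inn}(X_i)$; here $\{\psi_j:1\le j\le 2^{k'}\}$ is the complete set of inequivalent irreducible (degree-one) representations over $K$ of $\mathrm{Inn}(X_i)\cong\mathbb{Z}_2^{k'}$.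
   Context: The Takasaki quandle of a finite additive abelian group $H$ is the set $T=H$ with operation $a\triangleright b=2b-a$. For $x\in T$ let $R_x:T\to T$, $R_x(y)=y\triangleright x$; $\mathrm{Inn}(T)$ is the permutation group generated by all $R_x$, $x\in T$. The quandle ring $K[T]$ is the $K$-vector space with basis $T$ and the (in general non-associative) bilinear multiplication extending $\triangleright$. A right ideal of $K[T]$ is a $K$-subspace $I$ with $I\cdot K[T]\subseteq I$; it is simple if it is nonzero and contains no right ideals of $K[T]$ other than $0$ and itself. For an orbit $X_i$ of $\mathrm{Inn}(T)$ on $T$ (there are $2^{k+k'}$ of them), $\mathrm{Inn}(X_i)$ denotes the permutation group of $X_i$ generated by the restrictions $R_x|_{X_i}$ for all $x\in T$; it acts linearly on $K[X_i]$ by permuting the basis $X_i$. *)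

(* Defs.v *)
From HB Require Import structures.
From mathcomp Require Import all_boot all_order all_algebra all_fingroup.
From mathcomp Require Import all_character.
From mathcomp Require Import reals complex.

Set Implicit Arguments.
Unset Strict Implicit.
Unset Printing Implicit Defensive.

Import GRing.Theory.
Local Open Scope ring_scope.

Reserved Notation "x '|>' y" (at level 40, left associativity).
Reserved Notation "u ** v" (at level 40, left associativity).

(* Finite (right) quandles: right translations are injective, hence bijective
   since the carrier is finite. *)
HB.mixin Record isQuandle T of Finite T := {
  qop : T -> T -> T;
  qopxx : forall x, qop x x = x;
  qop_inj : forall x, injective (fun y => qop y x);
  qopD : forall x y z, qop (qop x y) z = qop (qop x z) (qop y z)
}.

#[short(type="finQuandleType")]
HB.structure Definition FinQuandle := { T of Finite T & isQuandle T }.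

Notation "x |> y" := (qop x y) : ring_scope.

Section InnerGroups.
Variable T : finQuandleType.

Definition rtrans (x : T) : {perm T} := perm (@qop_inj T x).

Definition Inn : {group {perm T}} := <<[set rtrans x | x : T]>>%G.

Definition Inn_orbits : {set {set T}} := [set orbit 'P Inn y | y : T].

(* A permutation of X is represented as a permutation of T supported in X;
   restr_perm X is the restriction to X of a permutation that stabilises X
   (as every right translation does when X is an orbit of Inn). *)
Definition Inn_on (X : {set T}) : {group {perm T}} :=
  <<[set restr_perm X (rtrans x) | x : T]>>%G.

End InnerGroups.

Section QuandleRing.
Variables (K : fieldType) (T : finQuandleType).

(* K[T]: the formal combination \sum_x a_x x is the function x |-> a_x. *)
Definition qring := {ffun T -> K^o}.
HB.instance Definition _ := Vector.on qring.

Definition qbasis (x : T) : qring := [ffun y => (y == x)%:R].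

Definition qmul (u v : qring) : qring :=
  \sum_x \sum_y (u x * v y) *: qbasis (x |> y).

Local Notation "u ** v" := (qmul u v).

Definition right_ideal (I : {vspace qring}) : Prop :=
  forall u v, u \in I -> u ** v \in I.

Definition simple_right_ideal (I : {vspace qring}) : Prop :=
  [/\ right_ideal I, I <> 0%VS
    & forall J : {vspace qring},
        right_ideal J -> (J <= I)%VS -> J = 0%VS \/ J = I].

Definition qspan (X : {set T}) : {vspace qring} :=
  <<[seq qbasis x | x <- enum X]>>%VS.

Definition qact (u : qring) (s : {perm T}) : qring :=
  \sum_x u x *: qbasis (s x).

(* The subspace U is stable under G and affords psi. Permutations compose
   from left to right, so qact is a right action, matching the row-vector
   convention of mx_representation. *)
Definition affords (G : {group {perm T}}) n
    (psi : mx_representation K G n) (U : {vspace qring}) : Prop :=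
  exists2 b : n.-tuple qring, basis_of U b
    & forall s, s \in G -> forall i : 'I_n,
        qact (tnth b i) s = \sum_(j < n) psi s i j *: tnth b j.

End QuandleRing.

Arguments qspan K {T} X.

Definition complete_irreducibles (K : fieldType) (gT : finGroupType)
    (G : {group gT}) d N (psi : 'I_N -> mx_representation K G d) : Prop :=
  [/\ forall j, mx_irreducible (psi j),
      forall j1 j2, mx_rsim (psi j1) (psi j2) -> j1 = j2
    & forall n (rG : mx_representation K G n),
        mx_irreducible rG -> exists j, mx_rsim rG (psi j)].

Definition takasaki (H : Type) : Type := H.

Section Takasaki.
Variable H : finZmodType.
Implicit Types x y z : H.

Definition takasaki_op x y : H := y *+ 2 - x.

Let op_xx x : takasaki_op x x = x.
Proof. by rewrite /takasaki_op mulr2n addrK. Qed.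

Let op_inj x : injective (fun y => takasaki_op y x).
Proof. by move=> y z /addrI /oppr_inj. Qed.

Let op_D x y z :
  takasaki_op (takasaki_op x y) z
  = takasaki_op (takasaki_op x z) (takasaki_op y z).
Proof.
rewrite /takasaki_op mulrnBl opprB (mulr2n (z *+ 2)) opprB.
by rewrite [RHS]addrC [RHS]addrA [x - _ + _]addrA subrK addrA [x + _]addrC.
Qed.

HB.instance Definition _ := Finite.copy (takasaki H) H.
HB.instance Definition _ :=
  isQuandle.Build (takasaki H) op_xx op_inj op_D.

End Takasaki.

(* Make the finZmodType structure of binary products available. *)
HB.saturate prod.

Definition Z2Z4 (k k' : nat) : finZmodType :=
  ('rV['Z_2]_k * 'rV['Z_4]_k')%type.

(* Main.v *)
Require Import Defs.
From HB Require Import structures.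
From mathcomp Require Import all_boot all_order all_algebra all_fingroup.
From mathcomp Require Import all_solvable all_character.
From mathcomp Require Import ring boolp reals complex.

Set Implicit Arguments.
Unset Strict Implicit.
Unset Printing Implicit Defensive.

Import GRing.Theory.
Local Open Scope ring_scope.

(** Let H be the underlying group and 2H its subgroup of doubles. Every right
    translation sends y + 2d to y + 2(x - y - d), and y + 2d is the image of y
    under the translation of y + d; so the orbits of Inn are exactly the cosets
    of 2H (takasaki_orbitE). Since 4H = 0, doubling does not see signs, and on
    X = y + 2H the right translation of x is the shift by 2(x - y)
    (Inn_on_takasaki_translation). Hence G = Inn(X) is the group of shifts of X
    by 2H: an elementary abelian 2-group acting regularly on X, of order
    |2H| = 2^k'.

    Right multiplication by v in the quandle ring is a combination of the
    actions of right translations (qmulE), so right ideals are submodules for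
    Inn. For a degree-one representation r of G and a base point x0 of X, the
    vector sum_s r(s^-1) e_(s x0) is an eigenvector with character r
    (eigenvec_act); it spans a right ideal, which is simple because it is a
    line. Orthogonality of distinct characters (lin_val_orthogonal) makes the
    eigenvectors of inequivalent representations linearly independent
    (eigenvec_free). As there are |G| = |X| of them, they fill K[X]
    (regular_orbit_decomposition); summing over the orbits gives all of K[T],
    and counting dimensions shows that the whole sum is direct.

    Over a field where 2 is invertible, an irreducible representation of an
    elementary abelian 2-group has degree one (abelem2_irr_degree1): by Schur's
    lemma each involution acts as 1 or -1. The field is then a splitting field,
    so there are as many irreducible representations as conjugacy classes,
    namely |G| (abelem2_complete_irreducibles). *)

(** * Representations of elementary abelian 2-groups *)

Section ElementaryAbelian.
Variables (K : fieldType) (gT : finGroupType) (G : {group gT}).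
Hypotheses (abelG : (2.-abelem G)%g) (K2 : 2%:R != 0 :> K).

(** For an involution s, either rG s = 1 or rG s - 1 is a nonzero intertwiner,
    hence invertible, which forces rG s = -1. The group acts by scalars, so any
    line is a submodule. *)
Lemma abelem2_irr_degree1 n (rG : mx_representation K G n) :
  mx_irreducible rG -> n = 1%N.
Proof.
have [cGG G2] := abelemP (isT : prime 2) abelG.
case: n rG => [|n] rG irrG; first by case/mx_irrP: irrG.
have scalG s : s \in G -> exists a, rG s = a%:M.
  move=> Gs; rewrite -[rG s](subrK (rG 1%g)); set f := rG s - rG 1%g.
  have [->|nz_f] := eqVneq f 0; first by exists 1; rewrite add0r repr_mx1.
  have cent_f : centgmx rG f.
    apply/centgmxP=> x Gx; rewrite mulmxBl mulmxBr -!repr_mxM //.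
    by rewrite (centsP cGG s Gs x Gx) mulg1 mul1g.
  have unit_f := mx_Schur irrG cent_f nz_f.
  (* As s is an involution, f is annihilated by rG s + 1. *)
  have ss : (s * s = 1)%g by apply: G2.
  exists (- 1); rewrite subrK; apply/eqP.
  rewrite raddfN /= -(repr_mx1 rG) -subr_eq0 opprK -(mulKmx unit_f (_ + _)).
  rewrite mulmxDr !mulmxBl -!repr_mxM // ss mulg1.
  by rewrite mul1g mulg1 addrA subrK subrr mulmx0.
have [_ /(_ (delta_mx 0 0))] := (mx_irrP rG).1 irrG.
have -> : mxmodule rG (delta_mx 0 0 : 'M_n.+1).
  by apply/mxmoduleP=> s /scalG[a ->]; rewrite mul_mx_scalar scalemx_sub.
rewrite -mxrank_eq0 /row_full mxrank_delta => full.
by have /eqP[<-] := full isT isT.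
Qed.

Lemma pchar'_abelem2 : ([pchar K]^'.-group G)%g.
Proof.
apply: sub_pgroup (abelem_pgroup abelG) => q.
rewrite !inE => /eqP->; apply/negP=> /andP[_ z2].
by case/negP: K2.
Qed.

Lemma natr_card_abelem2 : #|G|%:R != 0 :> K.
Proof.
have [n ->] := p_natP (abelem_pgroup abelG).
by rewrite natrX expf_eq0 negb_and K2 orbT.
Qed.

(** The irreducible components of the regular representation form a complete
    family; their existence as an indexed type is only a classical fact over
    an arbitrary field. *)
Lemma abelem2_complete_irreducibles N : #|G| = N ->
  exists psi : 'I_N -> mx_representation K G 1, complete_irreducibles psi.
Proof.
move=> <- {N}.
have G'K := pchar'_abelem2; have cGG := abelem_abelian abelG.
apply: contrapT; apply/classicP=> b IH.
apply: (@socle_exists _ _ _ _ (regular_repr K G)) => sG; apply: IH.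
have splitG : group_splitting_field K G.
  by move=> n rG /abelem2_irr_degree1 n1; apply: linear_mx_abs_irr.
have oG : #|G| = #|sG|.
  rewrite (card_irr_pchar sG G'K splitG).
  by apply/esym/eqP; rewrite -card_classes_abelian.
pose rep (j : 'I_#|G|) : sG := enum_val (cast_ord oG j).
have rep_inj : injective rep by move=> i j /enum_val_inj/cast_ord_inj.
have deg1 (j : 'I_#|G|) :
    exists r : mx_representation K G 1, mx_rsim r (irr_repr (rep j)).
  move: (irr_repr (rep j)); rewrite (irr_degree_abelian splitG cGG) => r.
  by exists r; apply: mx_rsim_refl.
have [psi psiP] := fin_all_exists deg1; exists psi.
split=> [j | j1 j2 sim12 | n rG irrG].
- exact: mx_rsim_irr (mx_rsim_sym (psiP j)) (socle_irr _).
- have sim := mx_rsim_trans (mx_rsim_sym (psiP j1))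
                            (mx_rsim_trans sim12 (psiP j2)).
  have := irr_comp_rsim_pchar sG G'K sim.
  by rewrite !irr_reprK_pchar // => /rep_inj.
- exists (cast_ord (esym oG) (enum_rank (irr_comp sG rG))).
  apply: mx_rsim_trans (mx_rsim_sym (psiP _)).
  rewrite /rep cast_ordKV enum_rankK.
  exact: rsim_irr_comp_pchar.
Qed.

End ElementaryAbelian.

(** * Orthogonality of degree-one representations *)

Section LinearCharacters.
Variables (K : fieldType) (gT : finGroupType) (G : {group gT}).
Implicit Types r : mx_representation K G 1.

Definition lin_val r (s : gT) : K := r s 0 0.

Lemma lin_valM r : {in G &, {morph lin_val r : s t / (s * t)%g >-> s * t}}.
Proof.
move=> s t Gs Gt; rewrite /lin_val repr_mxM //.
by rewrite mxE big_ord1.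
Qed.

Lemma lin_val1 r : lin_val r 1%g = 1.
Proof. by rewrite /lin_val repr_mx1 mxE. Qed.

Lemma lin_valK r s : s \in G -> lin_val r s * lin_val r s^-1%g = 1.
Proof. by move=> Gs; rewrite -lin_valM ?groupV // mulgV lin_val1. Qed.

Lemma lin_val_rsim r1 r2 : {in G, lin_val r1 =1 lin_val r2} -> mx_rsim r1 r2.
Proof.
move=> eq12; exists 1%:M => //; first by rewrite row_free_unit unitmx1.
move=> s Gs; rewrite mulmx1 mul1mx; apply/matrixP=> i j; rewrite !ord1.
exact: eq12.
Qed.

Lemma lin_val_orthogonal r1 r2 : ~ mx_rsim r1 r2 ->
  \sum_(s in G) lin_val r1 s * lin_val r2 s^-1%g = 0.
Proof.
move=> not_sim; set S := \sum_(s in G) _.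
have [t Gt neq_t] : exists2 t, t \in G & lin_val r1 t != lin_val r2 t.
  apply/exists_inP; apply: contraPT not_sim; rewrite negb_exists_in.
  move=> /forall_inP eq12; case; apply: lin_val_rsim => s Gs.
  by apply/eqP; rewrite -[_ == _]negbK eq12.
(* Translating the summation index by t multiplies S by the ratio of the
   values of the two characters at t. *)
have StS : lin_val r2 t * S = lin_val r1 t * S.
  rewrite {1}/S (reindex_inj (mulgI t)) !mulr_sumr; apply: eq_big => s.
    by rewrite groupMl.
  rewrite groupMl // => Gs; rewrite lin_valM // invMg lin_valM ?groupV //.
  by rewrite -[RHS]mulr1 -[X in _ = _ * X](lin_valK r2 Gt); ring.
apply/eqP; move/eqP: StS; rewrite -subr_eq0 -mulrBl mulf_eq0 subr_eq0.
by rewrite eq_sym (negPf neq_t).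
Qed.

End LinearCharacters.

(* The permutation action on K[T], not the action on quotient groups. *)
Local Notation qact := Defs.qact.

(** * The quandle ring as a permutation module *)

Section QuandleRing.
Variables (K : fieldType) (T : finQuandleType).
Implicit Types (u v : qring K T) (X : {set T}) (s : {perm T}).

Lemma qringE u : u = \sum_x u x *: qbasis K x.
Proof.
apply/ffunP=> y; rewrite sum_ffunE (bigD1 y) //= !ffunE eqxx.
rewrite big1 ?addr0 => [|x neq_xy]; first by rewrite /GRing.scale /= mulr1.
by rewrite !ffunE eq_sym (negPf neq_xy) scaler0.
Qed.

Lemma qactE u s y : qact u s y = u (s^-1%g y).
Proof.
rewrite sum_ffunE (bigD1 (s^-1%g y)) //= !ffunE permKV eqxx.
rewrite big1 ?addr0 => [|x neq_xy]; first by rewrite /GRing.scale /= mulr1.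
rewrite !ffunE -(inj_eq (@perm_inj _ s^-1)) permK eq_sym (negPf neq_xy).
exact: scaler0.
Qed.

Lemma qact_sum (I : finType) (P : {pred I}) (c : I -> K) (f : I -> T) s :
  qact (\sum_(i in P) c i *: qbasis K (f i)) s
  = \sum_(i in P) c i *: qbasis K (s (f i)).
Proof.
apply/ffunP=> y; rewrite qactE !sum_ffunE; apply: eq_bigr => i _.
by rewrite !ffunE -(inj_eq (@perm_inj _ s)) permKV.
Qed.

Lemma qactZ a u s : qact (a *: u) s = a *: qact u s.
Proof. by apply/ffunP=> y; rewrite [RHS]ffunE !qactE ffunE. Qed.

(** Right multiplication by a basis element [y] is the linear action of the
    right translation of [y]; a right ideal is thus a submodule for [Inn T]. *)
Lemma qmulE u v : qmul u v = \sum_y v y *: qact u (rtrans y).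
Proof.
rewrite /qmul exchange_big; apply: eq_bigr => y _.
rewrite /qact scaler_sumr; apply: eq_bigr => x _.
by rewrite scalerA mulrC permE.
Qed.

Lemma line_right_ideal u :
  (forall x, exists a, qact u (rtrans x) = a *: u) -> right_ideal <[u]>%VS.
Proof.
move=> eig w v /vlineP[c ->]; rewrite qmulE rpred_sum // => y _.
have [a u_a] := eig y.
by rewrite qactZ u_a !memvZ ?memv_line.
Qed.

Lemma simple_right_ideal_dim1 (I : {vspace qring K T}) :
  \dim I = 1%N -> right_ideal I -> simple_right_ideal I.
Proof.
move=> dimI idI; split=> // [I0 | J _ sJI]; first by rewrite I0 dimv0 in dimI.
have := dimvS sJI; rewrite dimI leq_eqVlt ltnS leqn0 dimv_eq0.
case/orP=> [/eqP dimJ | /eqP]; last by left.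
by right; apply/eqP; rewrite eqEdim sJI dimI dimJ.
Qed.

Lemma dim_qspan_le X : (\dim (qspan K X) <= #|X|)%N.
Proof. by rewrite (leq_trans (dim_span _)) // size_map cardE. Qed.

Lemma mem_qbasis_qspan X x : x \in X -> qbasis K x \in qspan K X.
Proof. by move=> Xx; rewrite memv_span // map_f // mem_enum. Qed.

Lemma dim_qring : \dim {:qring K T} = #|T|.
Proof. by rewrite dimvf /dim /= muln1. Qed.

End QuandleRing.

(** * Eigenlines of a regular permutation group *)

Section RegularOrbit.
Variables (K : fieldType) (T : finQuandleType) (X : {set T}) (x0 : T).
Let G := Inn_on X.
Hypothesis regG : {in G &, injective (fun s : {perm T} => s x0)}.
Hypothesis orbG : [set s x0 | s : {perm T} in G] = X.
Hypothesis stabX : forall x : T, rtrans x \in ('N(X | 'P))%g.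
Hypothesis nzG : #|G|%:R != 0 :> K.

(** Up to the factor |G|, the projection of the basis vector x0 onto the
    r-isotypic part of K[X]. *)
Definition eigenvec (r : mx_representation K G 1) : qring K T :=
  \sum_(s in G) lin_val r s^-1%g *: qbasis K (s x0).

Lemma eigenvec_act r t : t \in G ->
  qact (eigenvec r) t = lin_val r t *: eigenvec r.
Proof.
move=> Gt; rewrite /eigenvec qact_sum scaler_sumr.
rewrite [RHS](reindex_inj (mulIg t)); apply: eq_big => s.
  by rewrite groupMr.
move=> Gs; rewrite scalerA invMg lin_valM ?groupV // mulrA lin_valK // mul1r.
by rewrite permM.
Qed.

(** Being supported in X, an eigenvector sees a right translation only through
    its restriction to X, which lies in G. *)
Lemma eigenvec_rtrans r (x : T) :
  exists a, qact (eigenvec r) (rtrans x) = a *: eigenvec r.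
Proof.
have Gx : restr_perm X (rtrans x) \in G by apply/mem_gen/imset_f.
exists (lin_val r (restr_perm X (rtrans x))); rewrite -eigenvec_act //.
rewrite /eigenvec !qact_sum; apply: eq_bigr => s Gs; rewrite restr_permE //.
by rewrite -orbG imset_f.
Qed.

Lemma eigenvec_coord r s : s \in G -> eigenvec r (s x0) = lin_val r s^-1%g.
Proof.
move=> Gs; rewrite sum_ffunE (bigD1 s) //= !ffunE eqxx.
rewrite big1 ?addr0 => [|t /andP[Gt neq_ts]].
  by rewrite /GRing.scale /= mulr1.
rewrite !ffunE (inj_in_eq regG) // eq_sym (negPf neq_ts).
exact: scaler0.
Qed.

Lemma eigenvec_qspan r : eigenvec r \in qspan K X.
Proof.
rewrite rpred_sum // => s Gs; apply/memvZ/mem_qbasis_qspan.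
by rewrite -orbG imset_f.
Qed.

Lemma card_regular : #|X| = #|G|.
Proof. by rewrite -orbG card_in_imset. Qed.

(** Regularity turns the coordinates of an eigenvector on X into the values of
    its character, so that a linear relation is one between characters, which
    orthogonality forbids; this is where |G| must be invertible in K. *)
Lemma eigenvec_free N (psi : 'I_N -> mx_representation K G 1) :
    (forall j1 j2, mx_rsim (psi j1) (psi j2) -> j1 = j2) ->
  free [tuple eigenvec (psi j) | j < N].
Proof.
move=> inj_psi; apply/freeP=> c c0 i.
have c0s s : s \in G -> \sum_j c j * lin_val (psi j) s^-1%g = 0.
  move=> Gs; have /ffunP/(_ (s x0)) := c0.
  rewrite sum_ffunE [RHS]ffunE => c0s; rewrite -[RHS]c0s; apply: eq_bigr => j _.
  by rewrite ffunE -tnth_nth tnth_mktuple eigenvec_coord.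
apply: (mulIf nzG); rewrite mul0r.
transitivity (\sum_(s in G) lin_val (psi i) s *
                 \sum_j c j * lin_val (psi j) s^-1%g); last first.
  by rewrite big1 // => s Gs; rewrite c0s ?mulr0.
under eq_bigr => s _.
  rewrite mulr_sumr; under eq_bigr => j _ do rewrite mulrCA.
  over.
rewrite exchange_big (bigD1 i) //= [X in _ = _ + X]big1 ?addr0 => [|j neq_ji].
  rewrite -mulr_sumr; congr (_ * _).
  rewrite (eq_bigr (fun=> 1)) => [|s Gs]; first by rewrite sumr_const.
  exact: lin_valK.
rewrite -mulr_sumr lin_val_orthogonal ?mulr0 // => /inj_psi ij.
by rewrite ij eqxx in neq_ji.
Qed.

Lemma eigenvec_neq0 r : eigenvec r != 0.
Proof.
apply: contraTneq (oner_neq0 K) => /ffunP/(_ ((1%g : {perm T}) x0)).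
by rewrite eigenvec_coord // invg1 lin_val1 ffunE => ->; rewrite eqxx.
Qed.

(** The lines are independent, there are |G| = |X| of them, and they lie in
    K[X], whose dimension is at most |X|. *)
Lemma regular_orbit_decomposition N (psi : 'I_N -> mx_representation K G 1) :
    #|G| = N -> (forall j1 j2, mx_rsim (psi j1) (psi j2) -> j1 = j2) ->
  exists U : 'I_N -> {vspace qring K T},
    (\sum_j U j)%VS = qspan K X /\
    forall j, [/\ simple_right_ideal (U j), \dim (U j) = 1%N
                & affords (psi j) (U j)].
Proof.
move=> oG inj_psi; pose b j := eigenvec (psi j).
have dim_b j : \dim <[b j]> = 1%N by rewrite dim_vline eigenvec_neq0.
exists (fun j => <[b j]>%VS); split=> [|j].
  have -> : (\sum_j <[b j]>)%VS = <<[tuple b j | j < N]>>%VS.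
    by rewrite span_def big_map big_enum.
  apply/eqP; rewrite eqEdim; apply/andP; split.
    by apply/span_subvP=> _ /mapP[j _ ->]; apply: eigenvec_qspan.
  rewrite (eqnP (eigenvec_free inj_psi)) size_tuple -oG -card_regular.
  exact: dim_qspan_le.
split=> //.
  by apply/simple_right_ideal_dim1/line_right_ideal/eigenvec_rtrans.
exists [tuple b j].
  by rewrite basisEdim span_seq1 subvv dim_b.
move=> s Gs i; rewrite big_ord1 !ord1 (tnth_nth 0) /=.
exact: eigenvec_act.
Qed.

End RegularOrbit.

(** * Inner automorphisms of Takasaki quandles *)

Section TakasakiOrbits.
Variable H : finZmodType.
Implicit Types x y z d : H.
Let T : finQuandleType := takasaki H.

Lemma takasaki_rtransE x y : rtrans (x : T) y = x *+ 2 - y.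
Proof. by rewrite permE. Qed.

Definition coset_doubles y : {set T} := [set y + d *+ 2 | d : H].

Lemma rtrans_coset_doubles x y d :
  rtrans (x : T) (y + d *+ 2) = y + (x - y - d) *+ 2.
Proof.
rewrite takasaki_rtransE !mulrnBl (mulr2n y) opprD.
move: (x *+ 2) (d *+ 2) => a b; rewrite !addrA; congr (_ - _).
by rewrite [y + _]addrC opprD addrA addrK.
Qed.

Lemma rtrans_stab_coset_doubles (x : T) y :
  rtrans x \in ('N(coset_doubles y | 'P))%g.
Proof.
rewrite inE inE /=; apply/andP; split; first by rewrite inE.
apply/subsetP=> _ /imsetP[d _ ->]; rewrite inE /= /aperm rtrans_coset_doubles.
exact: imset_f.
Qed.

(** One right translation suffices to reach any point of y + 2H from y. *)
Lemma takasaki_orbitE y : orbit 'P%act (Inn T) (y : T) = coset_doubles y.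
Proof.
apply/eqP; rewrite eqEsubset; apply/andP; split.
  rewrite acts_sub_orbit.
    by apply/imsetP; exists 0; rewrite ?mul0rn ?addr0.
  rewrite gen_subG; apply/subsetP=> _ /imsetP[x _ ->].
  exact: rtrans_stab_coset_doubles.
apply/subsetP=> _ /imsetP[d _ ->]; apply/orbitP.
exists (rtrans (y + d : T)); first exact/mem_gen/imset_f.
by rewrite /= /aperm takasaki_rtransE mulrnDl addrAC mulr2n addrK.
Qed.

Lemma card_coset_doubles y : #|coset_doubles y| = #|coset_doubles 0|.
Proof.
rewrite -(card_imset (coset_doubles 0) (addrI y)) -imset_comp.
by congr #|pred_of_set _|; apply: eq_imset => d /=; rewrite add0r.
Qed.

Lemma card_takasaki_orbits :
  #|H| = (#|Inn_orbits T| * #|coset_doubles 0%R|)%N.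
Proof.
rewrite -cardsT; apply: card_uniform_partition.
  by move=> _ /imsetP[y _ ->]; rewrite takasaki_orbitE card_coset_doubles.
have := @orbit_partition _ _ _ 'P%act (Inn T) [set: T].
have -> : Inn_orbits T = [set orbit 'P%act (Inn T) y | y in [set: T]].
  apply/setP=> A.
  by apply/imsetP/imsetP=> -[y _ ->]; exists y; rewrite ?inE.
by apply; apply/actsP=> s _ z; rewrite !inE.
Qed.

Hypothesis H4 : forall x, x *+ 4 = 0.

Lemma double_opp d : (- d) *+ 2 = d *+ 2.
Proof. by apply/eqP; rewrite -subr_eq0 mulNrn -opprD -mulrnDr H4 oppr0. Qed.

Section OneOrbit.
Variable y : H.
Let X := coset_doubles y.

(** The right translation of x acts on y + 2H as a reflection, which is the
    shift by 2(x - y) because doubles are fixed by negation. *)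
Lemma Inn_on_takasaki_translation s : s \in Inn_on X ->
  perm_on X s /\ exists d, {in X, forall z, s z = z + d *+ 2 :> H}.
Proof.
case/gen_prodgP=> n [c c_gen ->] {s}.
elim/big_ind: _ => [| s t [onXs [d sd]] [onXt [e te]] | i _].
- by split; [apply: perm_on1 | exists 0 => z _; rewrite perm1 mul0rn addr0].
- split; first exact: perm_onM.
  exists (d + e) => z Xz.
  by rewrite permM te ?perm_closed // sd // mulrnDl -addrA.
- have /imsetP[x _ ->] := c_gen i; split; first exact: restr_perm_on.
  exists (x - y) => z Xz; rewrite restr_permE ?rtrans_stab_coset_doubles //.
  case/imsetP: Xz => d _ ->; rewrite rtrans_coset_doubles.
  by rewrite mulrnDl double_opp [X in y + X]addrC; apply: addrA.
Qed.

Lemma Inn_on_takasaki_abelem : (2.-abelem (Inn_on X))%g.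
Proof.
apply/(abelemP (isT : prime 2)); split.
  apply/centsP=> s /Inn_on_takasaki_translation[onXs [d sd]].
  move=> t /Inn_on_takasaki_translation[onXt [e te]]; apply/permP=> z.
  rewrite !permM; have [Xz | X'z] := boolP (z \in X).
    rewrite te ?perm_closed // (sd z) // (sd (t z)) ?perm_closed // te //.
    exact: addrAC.
  by rewrite (out_perm onXs X'z) !(out_perm onXt X'z) (out_perm onXs X'z).
move=> s /Inn_on_takasaki_translation[onXs [d sd]]; apply/permP=> z.
rewrite expgS expg1 permM perm1; have [Xz | X'z] := boolP (z \in X).
  by rewrite sd ?perm_closed // sd // -[LHS]addrA -mulrnDr H4 addr0.
by rewrite !(out_perm onXs X'z).
Qed.

Lemma Inn_on_takasaki_regular :
  {in Inn_on X &, injective (fun s : {perm T} => s y)}.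
Proof.
have Xy : y \in X by apply/imsetP; exists 0; rewrite ?mul0rn ?addr0.
move=> s t /Inn_on_takasaki_translation[onXs [d sd]].
move=> /Inn_on_takasaki_translation[onXt [e te]] /=.
rewrite sd // te // => /addrI de; apply/permP=> z.
have [Xz | X'z] := boolP (z \in X); first by rewrite sd // te // de.
by rewrite (out_perm onXs X'z) (out_perm onXt X'z).
Qed.

Lemma Inn_on_takasaki_transitive : [set s y | s : {perm T} in Inn_on X] = X.
Proof.
have Xy : y \in X by apply/imsetP; exists 0; rewrite ?mul0rn ?addr0.
apply/eqP; rewrite eqEsubset; apply/andP; split.
  apply/subsetP=> _ /imsetP[s /Inn_on_takasaki_translation[onXs _] ->].
  by rewrite perm_closed.
apply/subsetP=> _ /imsetP[d _ ->]; apply/imsetP.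
exists (restr_perm X (rtrans (y + d : T))); first exact/mem_gen/imset_f.
rewrite restr_permE ?rtrans_stab_coset_doubles // takasaki_rtransE.
by rewrite mulrnDl addrAC mulr2n addrK.
Qed.

Lemma card_Inn_on_takasaki : #|Inn_on X| = #|coset_doubles 0|.
Proof.
rewrite -(card_coset_doubles y).
exact: esym (card_regular Inn_on_takasaki_regular Inn_on_takasaki_transitive).
Qed.

End OneOrbit.
End TakasakiOrbits.

(** * The group Z2^k x Z4^k' and its doubles *)

Section Doubles.
Variables k k' : nat.
Let H := Z2Z4 k k'.

Lemma Z2Z4_mulrn (u : 'rV['Z_2]_k) (v : 'rV['Z_4]_k') n :
  (u, v) *+ n = (u *+ n, v *+ n) :> H.
Proof. by elim: n => // n IHn; rewrite !mulrS IHn. Qed.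

Lemma Z2Z4_mul4 (x : H) : x *+ 4 = 0.
Proof.
case: x => u v; rewrite Z2Z4_mulrn.
congr (_, _); apply/rowP=> i; rewrite mulmxnE mxE; apply/eqP.
  by case: (u 0 i) => [[|[]]].
by case: (v 0 i) => [[|[|[|[]]]]].
Qed.

Lemma card_Z2Z4 : #|H| = (2 ^ (k + k') * 2 ^ k')%N.
Proof.
by rewrite expnD -mulnA -expnMn card_prod !card_mx !card_ord !mul1n.
Qed.

(** The isomorphism of Z/2 onto the subgroup of doubles in Z/4. *)
Definition twice_lift (a : 'Z_2) : 'Z_4 := (a : nat)%:R *+ 2.

Lemma twice_lift_inj : injective twice_lift.
Proof. by case=> [[|[|a]] ?] // [[|[|b]] ?] // ?; apply: val_inj. Qed.

Lemma twice_liftP (a : 'Z_4) : exists b, a *+ 2 = twice_lift b.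
Proof.
by exists (inZp a); apply/eqP; case: a => [[|[|[|[]]]]].
Qed.

Lemma card_doubles_Z2Z4 : #|coset_doubles (0 : H)| = (2 ^ k')%N.
Proof.
pose g (w : 'rV['Z_2]_k') : H := (0, map_mx twice_lift w).
have g_inj : injective g.
  move=> w1 w2 [] /rowP eq_w; apply/rowP=> i; apply: twice_lift_inj.
  by have := eq_w i; rewrite !mxE.
have -> : coset_doubles (0 : H) = [set g w | w in 'rV['Z_2]_k'].
  apply/setP=> x; apply/imsetP/imsetP=> [[[u v] _ ->] | [w _ ->]].
    have [b bP] := fin_all_exists (fun i => twice_liftP (v 0 i)).
    exists (\row_i b i) => //; rewrite add0r Z2Z4_mulrn; congr (_, _).
      apply/rowP=> i; rewrite mulmxnE mxE; apply/eqP.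
      by case: (u 0 i) => [[|[]]].
    by apply/rowP=> i; rewrite mulmxnE !mxE.
  exists (0, map_mx (fun a : 'Z_2 => (a : nat)%:R) w) => //.
  rewrite add0r Z2Z4_mulrn mul0rn; congr (_, _).
  by apply/rowP=> i; rewrite mulmxnE !mxE.
by rewrite card_imset // card_mx card_ord mul1n.
Qed.

Lemma rV2_abelem : (2.-abelem [set: 'rV['Z_2]_k'])%g.
Proof.
apply/(abelemP (isT : prime 2)); split; first exact: FinRing.zmod_abelian.
move=> v _; rewrite FinRing.zmodXgE; apply/rowP=> i.
rewrite mulmxnE mxE; apply/eqP.
by case: (v 0 i) => [[|[]]].
Qed.

Lemma card_Inn_orbits_Z2Z4 : #|Inn_orbits (takasaki H)| = (2 ^ (k + k'))%N.
Proof.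
apply/eqP; rewrite -(eqn_pmul2r (expn_gt0 2 k')) -card_Z2Z4.
by rewrite (card_takasaki_orbits H) card_doubles_Z2Z4.
Qed.

End Doubles.

(** * Decomposition of the quandle ring *)

Theorem theorem6p12 (R : realType) (K : fieldType)
    (hK : K = (R : fieldType) \/ K = (R[i] : fieldType)) (k k' : nat) :
  let T : finQuandleType := takasaki (Z2Z4 k k') in
  #|Inn_orbits T| = (2 ^ (k + k'))%N /\
  forall (X : 'I_(2 ^ (k + k')) -> {set T}),
    injective X -> [set X i | i : 'I_(2 ^ (k + k'))] = Inn_orbits T ->
    [/\ forall i, Inn_on (X i) \isog [set: 'rV['Z_2]_k'],
        forall i, exists psi : 'I_(2 ^ k') -> mx_representation K (Inn_on (X i)) 1,
          complete_irreducibles psi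
      & forall psi : forall i, 'I_(2 ^ k') -> mx_representation K (Inn_on (X i)) 1,
          (forall i, complete_irreducibles (psi i)) ->
          exists U : 'I_(2 ^ (k + k')) -> 'I_(2 ^ k') -> {vspace qring K T},
            [/\ (\sum_i \sum_j U i j)%VS = fullv,
                directv (\sum_i \sum_j U i j),
                forall i, (\sum_j U i j)%VS = qspan K (X i)
              & forall i j,
                  [/\ simple_right_ideal (U i j), \dim (U i j) = 1%N
                    & affords (psi i j) (U i j)]]].
Proof.
move=> T; split; first exact: card_Inn_orbits_Z2Z4.
move=> X injX X_orbits; pose H := Z2Z4 k k'.
have K2 : 2%:R != 0 :> K by case: hK => ->; rewrite Num.Theory.pnatr_eq0.
have H4 := @Z2Z4_mul4 k k'.
have Xorb i : exists y : H, X i = coset_doubles y.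
  have : X i \in Inn_orbits T by rewrite -X_orbits imset_f.
  by case/imsetP=> y _ ->; exists y; rewrite -takasaki_orbitE.
have abelX i : (2.-abelem (Inn_on (X i)))%g.
  by have [y ->] := Xorb i; apply: Inn_on_takasaki_abelem.
have cardX i : #|Inn_on (X i)| = (2 ^ k')%N.
  have [y ->] := Xorb i.
  by rewrite (card_Inn_on_takasaki H4) card_doubles_Z2Z4.
split=> [i | i | psi psiP].
- rewrite (isog_abelem_card _ (abelX i)) rV2_abelem cardX cardsT.
  by rewrite card_mx card_ord mul1n /=.
- exact: abelem2_complete_irreducibles.
have decX i : exists U : 'I_(2 ^ k') -> {vspace qring K T},
    (\sum_j U j)%VS = qspan K (X i) /\
    forall j, [/\ simple_right_ideal (U j), \dim (U j) = 1%N
                & affords (psi i j) (U j)].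
  have [_ inj_psi _] := psiP i; have := cardX i.
  have nzG := natr_card_abelem2 (abelX i) K2; move: (psi i) inj_psi nzG.
  have [y ->] := Xorb i => psi_i inj_psi nzG oG.
  apply: regular_orbit_decomposition nzG _ _ oG inj_psi.
  - exact: Inn_on_takasaki_regular.
  - exact: Inn_on_takasaki_transitive.
  - by move=> x; apply: rtrans_stab_coset_doubles.
have [U UP] := fin_all_exists decX; exists U.
(* The orbit of x is some X i, so the basis vector x lies in the i-th block. *)
have sumU : (\sum_i \sum_j U i j)%VS = fullv.
  apply/eqP; rewrite eqEsubv subvf; apply/subvP=> u _.
  rewrite (qringE u) rpred_sum // => x _; apply: memvZ.
  have : orbit 'P%act (Inn T) x \in Inn_orbits T by apply: imset_f.
  rewrite -X_orbits => /imsetP[i _ def_Xi].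
  apply: (subvP (sumv_sup i _ (subvv _))) => //; rewrite (UP i).1.
  by apply: mem_qbasis_qspan; rewrite -def_Xi orbit_refl.
split=> // [|i|i j]; [|exact: (UP i).1|exact: (UP i).2].
(* The sum is direct because the dimensions of its terms add up to |T|. *)
rewrite directvE /= sumU dim_qring.
rewrite (eq_bigr (fun=> 2 ^ k')%N) => [|i _].
  by rewrite sum_nat_const card_ord -card_Z2Z4.
rewrite (eq_bigr (fun=> 1%N)) => [|j _]; last by case: ((UP i).2 j).
by rewrite sum_nat_const card_ord muln1.
Qed.
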